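(* Let $F$ be a field. If $X$ is an infinite subset of $\operatorname{Zar}(F)$ such that $A(X)$ is a local ring, then $J(\lim X)\subseteq A(X)$.
   Context: A valuation ring of the field $F$ is a subring $V$ of $F$ such that for each $0\ne t\in F$, $t\in V$ or $t^{-1}\in V$ (so $F$ itself is one); $\mathfrak M_V$ denotes its maximal ideal, and $\operatorname{Zar}(F)$ is the set of all valuation rings of $F$. For nonempty $X\subseteq\operatorname{Zar}(F)$ put $A(X)=\bigcap_{V\in X}V$ and $J(X)=\bigcap_{V\in X}\mathfrak M_V$. The patch topology on $\operatorname{Zar}(F)$ is the topology having as a basis the sets $\{V: x_1,\dots,x_n\in V,\ y_1\notin V,\dots,y_m\notin V\}$ with $x_i,y_j\in F$, $n,m\ge 0$ (it is compact Hausdorff). $\lim(X)$ is the set of limit points of $X$ in $\operatorname{Zar}(F)$ in the patch topology, i.e. those $U\in\operatorname{Zar}(F)$ such that every patch open neighborhood of $U$ contains a point of $X$ different from $U$; it is nonempty when $X$ is infinite. A local ring is a commutative ring with a unique maximal ideal (not necessarily Noetherian). *)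

(* Defs.v *)
From HB Require Import structures.
From mathcomp Require Import all_boot all_order all_algebra.
From mathcomp Require Import all_classical topology.

Set Implicit Arguments.
Unset Strict Implicit.
Unset Printing Implicit Defensive.

Import GRing.Theory.
Local Open Scope classical_set_scope.
Local Open Scope ring_scope.

(* Subrings of F are sets of elements of F, and an ideal of a subring A is a
   subset of F contained in A. *)
Section Ideals.
Variable F : fieldType.
Implicit Types A I : set F.

Definition is_subring A := subring_closed (mem A).

Definition ideal_of A I :=
  [/\ I `<=` A, I 0, forall x y, I x -> I y -> I (x + y)
    & forall a x, A a -> I x -> I (a * x)].

Definition maximal_ideal A I :=
  [/\ ideal_of A I, I <> A
    & forall K, ideal_of A K -> K <> A -> I `<=` K -> K = I].

Definition local_ring A := is_subring A /\ exists! M, maximal_ideal A M.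

Lemma is_subringP A : is_subring A <->
  [/\ A 1, forall x y, A x -> A y -> A (x - y)
    & forall x y, A x -> A y -> A (x * y)].
Proof.
split=> -[A1 AB AM]; split.
- by move: A1; rewrite inE.
- by move=> x y Ax Ay; have := AB x y; rewrite !inE; apply.
- by move=> x y Ax Ay; have := AM x y; rewrite !inE; apply.
- by rewrite inE.
- by move=> x y; rewrite !inE; apply: AB.
- by move=> x y; rewrite !inE; apply: AM.
Qed.

End Ideals.

Definition is_valuation_ring (F : fieldType) (V : set F) :=
  is_subring V /\ forall t : F, t != 0 -> V t \/ V t^-1.

Record Zar (F : fieldType) := MkZar {
  vring :> set F;
  vring_valuation : is_valuation_ring vring }.

Lemma vring_inj (F : fieldType) : injective (@vring F).
Proof.
move=> [V hV] [W hW] /= eVW; subst W.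
by congr MkZar; apply: Prop_irrelevance.
Qed.

HB.instance Definition _ (F : fieldType) := gen_eqMixin (Zar F).
HB.instance Definition _ (F : fieldType) := gen_choiceMixin (Zar F).

Section PatchTopology.
Variable F : fieldType.

(* The pair (xs, ys) stands for the basic set given by x_1, ..., x_n and
   y_1, ..., y_m. *)
Definition patch_index : Type := (seq F * seq F)%type.
HB.instance Definition _ := Choice.on patch_index.
HB.instance Definition _ := isPointed.Build patch_index ([::], [::]).

Definition patch_basic (s : patch_index) : set (Zar F) :=
  [set V | {in s.1, forall x, vring V x} /\ {in s.2, forall y, ~ vring V y}].

Lemma patch_cover : \bigcup_(s in [set: patch_index]) patch_basic s = setT.
Proof. by apply/seteqP; split=> // V _; exists ([::], [::]). Qed.

Lemma patch_join (s t : patch_index) (V : Zar F) :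
  [set: patch_index] s -> [set: patch_index] t ->
  patch_basic s V -> patch_basic t V ->
  exists u, [/\ [set: patch_index] u, patch_basic u V
              & patch_basic u `<=` patch_basic s `&` patch_basic t].
Proof.
move=> _ _ [sV sNV] [tV tNV].
exists (s.1 ++ t.1, s.2 ++ t.2); split=> //=.
- split=> x /=; rewrite mem_cat => /orP[].
  + exact: sV.
  + exact: tV.
  + exact: sNV.
  + exact: tNV.
- move=> W [/= WI WN]; split; split=> x xs;
    by [apply: WI; rewrite mem_cat xs ?orbT | apply: WN; rewrite mem_cat xs ?orbT].
Qed.

HB.instance Definition _ := isBaseTopological.Build (Zar F) patch_cover patch_join.

Lemma patch_openE (O : set (Zar F)) :
  open O <-> exists2 D : set patch_index, D `<=` setT
                & \bigcup_(s in D) patch_basic s = O.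
Proof. by split=> -[D hD <-]; exists D. Qed.

Lemma limit_pointP (X : set (Zar F)) (U : Zar F) :
  limit_point X U <->
  forall s, patch_basic s U -> exists V, [/\ V <> U, X V & patch_basic s V].
Proof.
split=> [XU s sU|XU O].
- have [|V [/eqP VU XV sV]] := XU (patch_basic s); last by exists V.
  apply: open_nbhs_nbhs; split=> //; apply/patch_openE.
  by exists [set s] => //; rewrite bigcup_set1.
- rewrite nbhsE => -[B [/patch_openE[D _ <-] [s Ds sU]] BO].
  have [V [/eqP VU XV sV]] := XU _ sU.
  by exists V; split=> //; apply: BO; exists s.
Qed.

End PatchTopology.

Section MaximalIdeal.
Variable F : fieldType.
Implicit Type V : Zar F.

(* In MathComp 0^-1 = 0 belongs to V, so 0 has to be listed as a nonunit
   separately. *)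
Lemma valuation_ring_maximal (V : set F) (I : set F) : is_valuation_ring V ->
  maximal_ideal V I <-> I = [set x | V x /\ (x = 0 \/ ~ V x^-1)].
Proof.
move=> [/is_subringP[V1 VB VM] Vval].
have V0 : V 0 by rewrite -(subrr 1); apply: VB.
have VD x y : V x -> V y -> V (x + y).
  move=> Vx Vy; rewrite -[y]opprK; apply: (VB) => //.
  by rewrite -sub0r; apply: VB.
set N := [set x | _].
have N1 : ~ N 1 by move=> [_ []]; rewrite ?invr1 // => /eqP; rewrite oner_eq0.
have NM a x : V a -> N x -> N (a * x).
  move=> Va [Vx x0]; split; first exact: VM.
  have [->|a0] := eqVneq a 0; first by left; rewrite mul0r.
  case: x0 => [->|xV]; first by left; rewrite mulr0.
  right=> axV; apply: xV.
  rewrite (_ : x^-1 = a * (a * x)^-1); first exact: VM.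
  by rewrite invfM mulrA mulfV // mul1r.
have ND x y : N x -> N y -> N (x + y).
  move=> Nx Ny.
  have [->|x0] := eqVneq x 0; first by rewrite add0r.
  have [->|y0] := eqVneq y 0; first by rewrite addr0.
  have xy0 : x / y != 0 by rewrite mulf_neq0 ?invr_eq0.
  have [Vxy|Vyx] := Vval _ xy0.
    rewrite (_ : x + y = (x / y + 1) * y); first by apply: NM => //; apply: VD.
    by rewrite mulrDl mul1r divfK.
  rewrite (_ : x + y = (1 + (x / y)^-1) * x); first by apply: NM => //; apply: VD.
  by rewrite mulrDl mul1r invf_div divfK.
have idN : ideal_of V N by split=> //; [move=> x [] | split=> //; left].
have proper K : ideal_of V K -> K <> V -> K `<=` N.
  move=> [KV K0 KD KM] neKV x Kx; split; first exact: KV.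
  have [->|x0] := eqVneq x 0; [by left|right=> Vxi; apply: neKV].
  apply/seteqP; split=> // y Vy.
  by rewrite -[y]mulr1 -(mulVf x0); apply: (KM) => //; apply: KM.
have neN : N <> V by move=> e; apply: N1; rewrite e.
split=> [[idI neI maxI]|->].
- by rewrite (maxI N) //; apply: proper.
- split=> // K idK neK NK; apply/seteqP; split=> //; exact: proper.
Qed.

Lemma valuation_ring_local V : local_ring V.
Proof.
split; first by case: (vring_valuation V).
exists [set x | vring V x /\ (x = 0 \/ ~ vring V x^-1)].
have maxE I := valuation_ring_maximal I (vring_valuation V).
by split=> [|I /maxE]; [exact/maxE|].
Qed.

Definition max_ideal V : set F := sval (cid (valuation_ring_local V).2).

Lemma max_idealP V : maximal_ideal V (max_ideal V).
Proof. by rewrite /max_ideal; case: cid => M []. Qed.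

Lemma max_idealE V :
  max_ideal V = [set x | vring V x /\ (x = 0 \/ ~ vring V x^-1)].
Proof. exact/(valuation_ring_maximal _ (vring_valuation V))/max_idealP. Qed.

End MaximalIdeal.

Definition A_of (F : fieldType) (X : set (Zar F)) : set F :=
  \bigcap_(V in X) vring V.

Lemma A_of_subring (F : fieldType) (X : set (Zar F)) : is_subring (A_of X).
Proof.
have sub (V : Zar F) := (is_subringP (vring V)).1 (vring_valuation V).1.
apply/is_subringP; split=> [V _|x y Ax Ay V XV|x y Ax Ay V XV];
  have [V1 VB VM] := sub V.
- exact: V1.
- by apply: VB; [exact: Ax|exact: Ay].
- by apply: VM; [exact: Ax|exact: Ay].
Qed.

Definition J_of (F : fieldType) (X : set (Zar F)) : set F :=
  \bigcap_(V in X) max_ideal V.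

(* Main.v *)
Require Import Defs.
From mathcomp Require Import all_boot all_order all_algebra.
From mathcomp Require Import all_classical topology.
Local Open Scope classical_set_scope.

(** Let [t] be in the maximal ideal of every limit point of [X]. By compactness
    of the patch topology ([ex_limit_point]), [t] lies in the maximal ideal of
    all but finitely many [V] in [X]: the condition [t] not in [max_ideal V]
    means [t^-1] in [V] (and [t] nonzero), which is closed, so infinitely many
    exceptions would accumulate at a valuation ring violating the hypothesis.

    Suppose that some [V] in [X] does not contain [t]. For a monic integer
    polynomial [f] of positive degree with constant term 1, [b = f(t)] is 1
    modulo the maximal ideal of each [W] with [t] in that ideal, and it is outside
    each [V] that [t] is not in. It remains to control the finitely many [V] in
    which [t] is a unit, where [f(t)] might be a nonunit; a choice of [f] of the
    shape [1 + T * \prod_i f_i] avoids this ([ex_unimonic_value]). Then [b^-1]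
    is in [A_of X]; it lies in the maximal ideal of a ring of [X] that omits [t],
    while [1 - b^-1] lies in the maximal ideal of a ring of [X] whose maximal
    ideal contains [t], and such a ring exists because [X] is infinite. So [A_of X]
    contains two nonunits with sum 1, which a local ring does not
    ([local_ring_not_comaximal]).

    The properties of [f(t)] that matter are collected in [unimonic_value]. Its
    closure under products and under [b |-> 1 + t * b] is all that the construction
    uses, so the polynomials themselves do not appear. *)

Section Proof.

Set Implicit Arguments.
Unset Strict Implicit.
Unset Printing Implicit Defensive.
Import GRing.Theory.
Local Open Scope ring_scope.

(** * Ideals of local subrings *)

Lemma subring0 (F : fieldType) (A : set F) : is_subring A -> A 0.
Proof. by move=> /is_subringP[A1 AB _]; rewrite -(subrr 1); apply: AB. Qed.

Lemma subringD (F : fieldType) (A : set F) (x y : F) :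
  is_subring A -> A x -> A y -> A (x + y).
Proof.
move=> Asub Ax Ay; have [_ AB _] := (is_subringP A).1 Asub.
rewrite -[y]opprK; apply: (AB) => //.
by rewrite -sub0r; apply: AB => //; apply: subring0.
Qed.

Lemma proper_idealP (F : fieldType) (A I : set F) :
  is_subring A -> ideal_of A I -> I <> A <-> ~ I 1.
Proof.
move=> /is_subringP[A1 _ _] [IA _ _ IM]; split=> [nIA I1|nI1 eIA].
  apply: nIA; apply/seteqP; split=> // a Aa.
  by rewrite -[a]mulr1; apply: IM.
by apply: nI1; rewrite eIA.
Qed.

(** Zorn's lemma is applied to the sets [J] such that [I `|` J] is a proper
    ideal, not to the proper ideals that contain [I]: the union of the empty
    chain is then admissible too. *)
Lemma ex_maximal_ideal (F : fieldType) (A I : set F) :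
  is_subring A -> ideal_of A I -> ~ I 1 ->
  exists2 M, maximal_ideal A M & I `<=` M.
Proof.
move=> Asub idI nI1.
have [IA I0 ID IM] := idI.
pose P (J : set F) := ideal_of A (I `|` J) /\ ~ (I `|` J) 1.
have [C CP Ctot|M [[idM nM1] maxM]] := @Zorn_bigcup F P.
  split; last by case=> // -[J /CP[_ nJ1] J1]; apply: nJ1; right.
  split.
  - by move=> x [/IA//|[J /CP[[JA _ _ _] _] Jx]]; apply: JA; right.
  - by left.
  - have lift J x y : C J -> (I `|` J) x -> (I `|` J) y ->
        (I `|` \bigcup_(J in C) J) (x + y).
      move=> CJ Jx Jy; have [[_ _ JD _] _] := CP _ CJ.
      by case: (JD _ _ Jx Jy) => [|Jxy]; [left|right; exists J].
    move=> x y [Ix|[J CJ Jx]] [Iy|[K CK Ky]].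
    + by left; apply: ID.
    + by apply: (lift K) => //; [left|right].
    + by apply: (lift J) => //; [right|left].
    + have [JK|KJ] := Ctot _ _ CJ CK.
        by apply: (lift K) => //; right=> //; apply: JK.
      by apply: (lift J) => //; right=> //; apply: KJ.
  - move=> a x Aa [Ix|[J CJ Jx]]; first by left; apply: IM.
    have [[_ _ _ JM] _] := CP _ CJ.
    by have [|Jax] := JM a x Aa (or_intror Jx); [left|right; exists J].
exists (I `|` M); last by left.
split=> //; first exact/proper_idealP.
move=> K idK nKA IMK.
have nK1 : ~ K 1 by apply/(proper_idealP Asub).
have IUK : I `|` K = K by apply/setUidPr => x Ix; apply: IMK; left.
apply: contrapT => neK; apply: (maxM K); last by rewrite /P IUK.
split=> [|KM]; first by move=> x Mx; apply: IMK; right.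
by apply: neK; apply/seteqP; split=> // x /KM; right.
Qed.

(** By Zorn's lemma both ideals lie in the unique maximal ideal. *)
Lemma local_ring_not_comaximal (F : fieldType) (A I J : set F) (x y : F) :
  local_ring A -> ideal_of A I -> ~ I 1 -> ideal_of A J -> ~ J 1 ->
  I x -> J y -> x + y <> 1.
Proof.
move=> [Asub [M [[idM nMA _] Muniq]]] idI nI1 idJ nJ1 Ix Jy xy1.
have subM K : ideal_of A K -> ~ K 1 -> K `<=` M.
  by move=> idK nK1; have [N /Muniq ->] := ex_maximal_ideal Asub idK nK1.
have [_ _ MD _] := idM.
move/(proper_idealP Asub idM): nMA; apply; rewrite -xy1.
by apply: MD; [apply: subM Ix|apply: subM Jy].
Qed.

(** * Valuation rings and their maximal ideals *)

Lemma Zar_subring (F : fieldType) (V : Zar F) : is_subring (vring V).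
Proof. exact: (vring_valuation V).1. Qed.

Lemma max_ideal_ideal (F : fieldType) (V : Zar F) :
  ideal_of (vring V) (max_ideal V).
Proof. by case: (max_idealP V). Qed.

Lemma max_ideal_neq1 (F : fieldType) (V : Zar F) : ~ max_ideal V 1.
Proof.
case: (max_idealP V) => idM nMV _.
exact: (proper_idealP (Zar_subring V) idM).1 nMV.
Qed.

Lemma notin_max_ideal (F : fieldType) (V : Zar F) (x : F) :
  ~ max_ideal V x <-> x != 0 /\ vring V x^-1.
Proof.
rewrite max_idealE; split=> [nMx|[/eqP x0 Vx] [_ []//]].
have x0 : x != 0.
  apply/eqP => x0; apply: nMx; rewrite x0.
  by split; [apply: (subring0 (Zar_subring V))|left].
split=> //; apply: contrapT => nVx; apply: nMx; split; last by right.
by case: ((vring_valuation V).2 _ x0).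
Qed.

Lemma max_idealV (F : fieldType) (V : Zar F) (x : F) :
  ~ vring V x -> max_ideal V x^-1.
Proof.
by move=> nVx; apply: contrapT => /notin_max_ideal[_]; rewrite invrK.
Qed.

Lemma notin_max_idealM (F : fieldType) (V : Zar F) (x y : F) :
  ~ max_ideal V x -> ~ max_ideal V y -> ~ max_ideal V (x * y).
Proof.
move=> /notin_max_ideal[x0 Vx] nMy Mxy; apply: nMy.
have [_ _ _ MM] := max_ideal_ideal V.
by rewrite -(mulKf x0 y); apply: MM.
Qed.

Lemma notin_max_idealB1 (F : fieldType) (V : Zar F) (x : F) :
  max_ideal V (x - 1) -> ~ max_ideal V x.
Proof.
have [_ _ MD MM] := max_ideal_ideal V.
move=> Mx1 Mx; apply: (@max_ideal_neq1 _ V).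
rewrite (_ : 1 = x + (-1) * (x - 1)).
  apply: (MD) => //; apply: MM => //.
  have [V1 VB _] := (is_subringP _).1 (Zar_subring V).
  by rewrite -sub0r; apply: VB => //; apply: (subring0 (Zar_subring V)).
by rewrite mulN1r opprB addrCA subrr addr0.
Qed.

Lemma center_ideal (F : fieldType) (X : set (Zar F)) (V : Zar F) :
  X V -> ideal_of (A_of X) (A_of X `&` max_ideal V).
Proof.
move=> XV; have Asub := A_of_subring X.
have [_ M0 MD MM] := max_ideal_ideal V.
have [_ _ AM] := (is_subringP _).1 Asub.
split.
- by move=> x [].
- by split=> //; apply: subring0.
- by move=> x y [Ax Mx] [Ay My]; split; [apply: (subringD Asub)|apply: MD].
- move=> a x Aa [Ax Mx]; split; first exact: AM.
  by apply: MM => //; apply: Aa.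
Qed.

(** * Limit points in the patch topology *)

(** An ultrafilter containing [X] and every cofinite subset of [X] has as its limit
    [U], the set of the [x] that lie in almost all [V] of the ultrafilter. Maximality
    of the ultrafilter makes [U] a valuation ring: if almost no [V] contains [t],
    almost all contain [t^-1]. Since [X] minus the point [U] is in the ultrafilter,
    the neighbourhoods of [U] meet [X] in points other than [U]. *)
Lemma ex_limit_point (F : fieldType) (X : set (Zar F)) : infinite_set X ->
  exists2 U, limit_point X U &
    forall x, (forall V, X V -> vring V x) -> vring U x.
Proof.
move=> Xinf.
pose cof : set_system (Zar F) := [set S | finite_set (X `\` S)].
have cofP : ProperFilter cof.
  apply: Build_ProperFilter_ex => [S Sfin|].
    have [V [XV SV]] : X `\` (X `\` S) !=set0.
      apply/set0P/negP => /eqP e; apply: (infinite_setD Xinf Sfin).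
      by rewrite e; apply: finite_set0.
    by exists V; apply: contrapT => nSV; apply: SV.
  split.
  - by rewrite /cof /= setDT; apply: finite_set0.
  - by move=> S T Sfin Tfin; rewrite /cof /= setDIr finite_setU.
  - by move=> S T ST; apply: sub_finite_set; apply: setDS.
have [G [Gultra cofG]] := ultraFilterLemma cofP.
have GX S : X `<=` S -> G S.
  move=> XS; apply: cofG; rewrite /cof /= (_ : X `\` S = set0).
    exact: finite_set0.
  by apply/seteqP; split=> // V [/XS].
pose U := [set x | G [set V | vring V x]].
have Uval : is_valuation_ring U.
  split.
    apply/is_subringP; split.
    - by apply: GX => V _ /=; have [] := (is_subringP _).1 (Zar_subring V).
    - move=> x y Ux Uy; apply: filterS (filterI Ux Uy) => V [/= Vx Vy].
      by have [_ VB _] := (is_subringP _).1 (Zar_subring V); apply: VB.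
    - move=> x y Ux Uy; apply: filterS (filterI Ux Uy) => V [/= Vx Vy].
      by have [_ _ VM] := (is_subringP _).1 (Zar_subring V); apply: VM.
  move=> t t0.
  have [|nUt] := in_ultra_setVsetC [set V : Zar F | vring V t] Gultra.
    by left.
  right; apply: filterS nUt => V /= nVt.
  by case: ((vring_valuation V).2 _ t0).
exists (MkZar Uval) => [|x Xx]; last by apply: GX.
apply/limit_pointP => -[xs ys] [/= xsU ysU].
have Gxs : G [set V | {in xs, forall x, vring V x}].
  elim: xs xsU => [_|x xs IH xsU]; first exact: GX.
  have Ux : U x by apply: xsU; rewrite mem_head.
  have Uxs : {in xs, forall x, U x}.
    by move=> z zxs; apply: xsU; rewrite inE zxs orbT.
  apply: filterS (filterI Ux (IH Uxs)) => V [/= Vx Vxs] z.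
  by rewrite inE => /orP[/eqP ->|/Vxs].
have Gys : G [set V | {in ys, forall y, ~ vring V y}].
  elim: ys ysU => [_|y ys IH ysU]; first exact: GX.
  have Uy : G (~` [set V | vring V y]).
    have := ysU y (mem_head _ _); rewrite /U /=.
    by have [] := in_ultra_setVsetC [set V : Zar F | vring V y] Gultra.
  have Uys : {in ys, forall y, ~ U y}.
    by move=> z zys; apply: ysU; rewrite inE zys orbT.
  apply: filterS (filterI Uy (IH Uys)) => V [/= Vy Vys] z.
  by rewrite inE => /orP[/eqP ->|/Vys].
have GXU : G (X `\ MkZar Uval).
  apply: cofG; rewrite /cof /=.
  apply: sub_finite_set (finite_set1 (MkZar Uval)) => V [XV nV].
  by apply: contrapT => VU; apply: nV.
have [V [[/= XV VU] [Vxs Vys]]] :=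
  @filter_ex _ _ _ _ (filterI GXU (filterI Gxs Gys)).
by exists V.
Qed.

(** Infinitely many exceptions [V] would have a limit point [U]. All of them
    contain [t^-1], so [U] contains it too, against [t] in [max_ideal U]. *)
Lemma finite_notin_max_ideal (F : fieldType) (X : set (Zar F)) (t : F) :
  J_of (limit_point X) t -> finite_set (X `&` [set V | ~ max_ideal V t]).
Proof.
move=> Jt; apply: contrapT => Yinf.
have [U limU Uring] := ex_limit_point Yinf.
have XU : limit_point X U.
  apply/limit_pointP => s sU.
  have /limit_pointP/(_ s sU)[V [VU [XV _] sV]] := limU.
  by exists V.
suff : ~ max_ideal U t by apply; apply: Jt.
apply/notin_max_ideal; split; last first.
  by apply: Uring => V [_ /notin_max_ideal[]].
(* [0^-1 = 0] makes [t != 0] a separate goal, settled by any exception [V]. *)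
apply/eqP => t0.
have allU : patch_basic ([::], [::]) U by [].
have /limit_pointP/(_ _ allU)[V [_ [_ /notin_max_ideal[t_neq0 _]] _]] := limU.
by rewrite t0 eqxx in t_neq0.
Qed.

(** * Values of monic polynomials with constant term 1 *)

(** These three conditions retain of [b = f(t)], with [f] a monic integer
    polynomial whose constant term is 1, what valuation rings see of it;
    the last one reflects that [f(t) / t ^+ deg f] is 1 modulo the maximal ideal
    of [V] if [t] is not in [V]. *)
Definition unimonic_value (F : fieldType) (t : F) : set F :=
  [set b | forall V : Zar F,
    [/\ max_ideal V t -> max_ideal V (b - 1),
        vring V t -> vring V b
      & ~ vring V t -> ~ max_ideal V b]].

Lemma unimonic_value1 (F : fieldType) (t : F) : unimonic_value t 1.
Proof.
move=> V; have [_ M0 _ _] := max_ideal_ideal V; split.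
- by rewrite subrr.
- by have [] := (is_subringP _).1 (Zar_subring V).
- by move=> _; apply: max_ideal_neq1.
Qed.

Lemma unimonic_valueM (F : fieldType) (t b c : F) :
  unimonic_value t b -> unimonic_value t c -> unimonic_value t (b * c).
Proof.
move=> tb tc V.
have [bM bV bN] := tb V; have [cM cV cN] := tc V.
have [MV M0 MD MM] := max_ideal_ideal V.
have [_ _ VM] := (is_subringP _).1 (Zar_subring V).
split=> [Mt|Vt|nVt].
- rewrite (_ : b * c - 1 = b * (c - 1) + (b - 1)).
    apply: MD; last exact: bM.
    by apply: MM; [apply/bV/MV|apply: cM].
  by rewrite mulrBr mulr1 addrA subrK.
- by apply: VM; [apply: bV|apply: cV].
- by apply: notin_max_idealM; [apply: bN|apply: cN].
Qed.

(** Corresponds to passing from [f] to the polynomial [1 + T f] of positive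
    degree, so that the value leaves every [V] that [t] is not in. *)
Lemma unimonic_value_succ (F : fieldType) (t b : F) :
  unimonic_value t b ->
  unimonic_value t (1 + t * b) /\
    forall V : Zar F, ~ vring V t -> ~ vring V (1 + t * b).
Proof.
move=> tb.
have out (V : Zar F) : ~ vring V t -> ~ vring V (1 + t * b).
  move=> nVt Vtb.
  have [V1 VB _] := (is_subringP _).1 (Zar_subring V).
  have [_ _ bN] := tb V; apply: (bN nVt).
  have t0 : t != 0.
    by apply/eqP => t0; apply: nVt; rewrite t0; apply: (subring0 (Zar_subring V)).
  rewrite -(mulKf t0 b) mulrC.
  have [_ _ _ MM] := max_ideal_ideal V; apply: MM; last exact: max_idealV.
  by rewrite -[t * b](addKr 1) addrC; apply: VB.
split=> // V.
have [_ bV bN] := tb V.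
have [MV M0 MD MM] := max_ideal_ideal V.
have [V1 _ VM] := (is_subringP _).1 (Zar_subring V).
split=> [Mt|Vt|/out nV /MV //].
- rewrite addrC addKr mulrC; apply: MM => //; exact/bV/MV.
- by apply: (subringD (Zar_subring V)) => //; apply: VM => //; apply: bV.
Qed.

(** Choose for each [V] of the list a value [c V] in the maximal ideal of [V],
    if there is one. Then [b = 1 + t * \prod_V c V] avoids all these maximal
    ideals: [b] is 1 modulo the maximal ideal of [V] if [c V] exists, and
    otherwise no value at all lies in that maximal ideal. *)
Lemma ex_unimonic_value (F : fieldType) (t : F) (s : seq (Zar F)) :
  exists b, [/\ unimonic_value t b,
    forall V : Zar F, ~ vring V t -> ~ vring V b
    & {in s, forall V, ~ max_ideal V b}].
Proof.
have /choice[c cP] (V : Zar F) : exists c, unimonic_value t c /\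
    forall b, unimonic_value t b -> max_ideal V b -> max_ideal V c.
  have [[c [tc Mc]]|no] := pselect (exists c, unimonic_value t c /\ max_ideal V c).
    by exists c.
  exists 1; split; first exact: unimonic_value1.
  by move=> b tb Mb; case: no; exists b.
have [p tp pM] : exists2 p, unimonic_value t p &
    {in s, forall V, vring V t -> max_ideal V (c V) -> max_ideal V p}.
  elim: s => [|V s [p tp pM]]; first by exists 1; [apply: unimonic_value1|].
  have [tc _] := cP V; exists (c V * p); first exact: unimonic_valueM.
  move=> W; rewrite inE => /orP[/eqP ->|Ws] Wt Mc.
    have [_ _ _ MM] := max_ideal_ideal V; rewrite mulrC; apply: MM => //.
    by have [_ pV _] := tp V; apply: pV.
  have [_ _ _ MM] := max_ideal_ideal W; apply: MM; last exact: pM.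
  by have [_ cV _] := tc W; apply: cV.
have [tb bout] := unimonic_value_succ tp.
exists (1 + t * p); split=> // V Vs Mb.
have [_ _ bN] := tb V.
have [Vt|nVt] := pselect (vring V t); last exact: bN.
have Mp : max_ideal V p by apply: pM => //; apply: (cP V).2 Mb.
apply: (@notin_max_idealB1 _ V _ _ Mb).
have [_ _ _ MM] := max_ideal_ideal V.
by rewrite addrC addKr; apply: MM.
Qed.

(** The inverse [a] of the value [b] of [ex_unimonic_value] lies in every ring of
    [X], because [b] avoids the maximal ideals of all of them. It separates the
    rings that omit [t] from the rings of [X] with [t] in their maximal ideal. *)
Lemma ex_separating_element (F : fieldType) (X : set (Zar F)) (t : F) :
  X !=set0 -> finite_set (X `&` [set V | ~ max_ideal V t]) ->
  exists a, [/\ A_of X a,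
    forall V : Zar F, ~ vring V t -> max_ideal V a
    & forall V, X V -> max_ideal V t -> max_ideal V (1 - a)].
Proof.
move=> [W XW] /finite_seqP[s Es].
have [b [tb bout bs]] := ex_unimonic_value t s.
have nMb V : X V -> ~ max_ideal V b.
  move=> XV; have [Mt|nMt] := pselect (max_ideal V t).
    by apply: notin_max_idealB1; have [bM _ _] := tb V; apply: bM.
  apply: bs; suff : [set` s] V by [].
  by rewrite -Es.
have b0 : b != 0 by have /notin_max_ideal[] := nMb _ XW.
have Ab : A_of X b^-1 by move=> V /nMb /notin_max_ideal[].
exists b^-1; split=> // V; first by move=> /bout/max_idealV.
move=> XV Mt; rewrite (_ : 1 - b^-1 = b^-1 * (b - 1)).
  have [_ _ _ MM] := max_ideal_ideal V; apply: MM; first exact: Ab.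
  by have [bM _ _] := tb V; apply: bM.
by rewrite mulrBr mulVf // mulr1.
Qed.

End Proof.

Theorem lemma3p2 (F : fieldType) (X : set (Zar F)) (Xinf : infinite_set X)
    (Aloc : local_ring (A_of X)) :
  J_of (limit_point X) `<=` A_of X.
Proof.
move=> t Jt V XV; apply: contrapT => nVt.
have Yfin := finite_notin_max_ideal Jt.
have [W [XW nYW]] : (X `\` (X `&` [set V | ~ max_ideal V t])) !=set0.
  apply/set0P/negP => /eqP e; apply: (infinite_setD Xinf Yfin).
  by rewrite e; apply: finite_set0.
have MWt : max_ideal W t by apply: contrapT => nMt; apply: nYW.
have [a [Aa aV aW]] := ex_separating_element (ex_intro _ V XV) Yfin.
have [A1 AB _] := (is_subringP (A_of X)).1 Aloc.1.
have proper U : ~ (A_of X `&` max_ideal U) 1%R by move=> [_ /max_ideal_neq1].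
apply: (local_ring_not_comaximal (x := a) (y := (1 - a)%R) Aloc
  (center_ideal XV) (proper V) (center_ideal XW) (proper W)).
- by split=> //; apply: aV.
- by split; [apply: AB|apply: aW].
- by rewrite GRing.addrC GRing.subrK.
Qed.
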